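(* Let $\mathsf A=\mathsf A(z)$ be an $n\times n$ matrix of rational functions in $\mathbb C(z)$ and let $\Delta\in\mathbb C[z]$ be a common denominator of its entries. Let $\mathfrak R$ be a finitely generated $\mathbb Z$-subalgebra of $\mathbb C$ containing the coefficients of $\Delta$ and of the entries of $\Delta\mathsf A$, let $z_0\in\mathfrak R$ with $\Delta(z_0)\ne0$, and let $y_0\in\mathfrak R^n$. Define $\mathsf A_1=\mathsf A$, $\mathsf A_{m+1}=\frac{\partial \mathsf A_m}{\partial z}+\mathsf A_m\mathsf A$. If the solution $y$ of $\frac{\partial y}{\partial z}=\mathsf A y$ with initial value $y(z_0)=y_0$ is algebraic (all its entries are algebraic over $\mathbb C(z)$), then there is a nonzero $N\in\mathfrak R$ such that $$\text{the entries of }\ \frac{N^m\mathsf A_m(z_0)y_0}{m!}\ \text{ are in }\ \mathfrak R\quad\text{for all } m\in\mathbb N.$$ In other words, for all primes $p$ and all $k,m\in\mathbb N$ with $\mathrm{ord}_p(m!)\ge k$, the vector $\mathsf A_m(z_0)y_0$ is zero in the ring $\mathfrak R[\frac1N]/p^k\mathfrak R[\frac1N]$.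
   Context: $\mathrm{ord}_p$ is the $p$-adic valuation. The solution $y$ is the $n\times1$ vector of holomorphic functions near $z_0$ solving the equation; it satisfies $\frac{\partial^m y}{\partial z^m}=\mathsf A_m y$. *)

(* Defs.v *)
From HB Require Import structures.
From mathcomp Require Import all_boot all_order all_algebra ring.
From mathcomp Require Import complex fraction.
From mathcomp Require Import all_classical all_reals all_analysis.

Set Implicit Arguments.
Unset Strict Implicit.
Unset Printing Implicit Defensive.

Import Order.TTheory GRing.Theory Num.Theory.
Import numFieldNormedType.Exports.

Local Open Scope ring_scope.
Local Open Scope classical_set_scope.
Local Open Scope quotient_scope.

(* R[i] packaged as a numClosedFieldType: the topology and normed-module
   structures of a numFieldType are found on [Cplx R], not on the bare R[i]. *)
Definition Cplx (R : realType) : numClosedFieldType := R[i].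

Section RationalFunctions.
Variable K : fieldType.
Local Notation KX := {fraction {poly K}}.
Local Notation "x %:F" := (tofrac x).
Local Notation numer f := (frac (repr f)).1.
Local Notation denom f := (frac (repr f)).2.
Implicit Types (f : KX) (p q : {poly K}).

(* [repr f] is an arbitrary fraction representing f, possibly not in lowest
   terms.  The formal derivative does not depend on it (ratderivE); evaluation
   does, hence the reduction to lowest terms. *)
Definition ratderiv f : KX :=
  let n := numer f in let d := denom f in
  (n^`() * d - n * d^`())%:F / (d ^+ 2)%:F.

Definition ratnum f : {poly K} :=
  let n := numer f in let d := denom f in n %/ gcdp n d.

Definition ratden f : {poly K} :=
  let n := numer f in let d := denom f in d %/ gcdp n d.

(* Equal to 0 when z is a pole of f. *)
Definition rateval f (z : K) : K := (ratnum f).[z] / (ratden f).[z].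

Lemma fracE f : f = (numer f)%:F / (denom f)%:F.
Proof.
have d0 : (denom f)%:F != 0 by rewrite tofrac_eq0 denom_ratioP.
apply: (mulIf d0); rewrite divfK //.
rewrite -{1}[f]reprK; unlock tofrac.
rewrite -[LHS]FracField.pi_mul; apply/eqmodP.
rewrite /= FracField.equivfE /FracField.mulf.
rewrite !numden_Ratio ?oner_neq0 ?mulf_neq0 ?oner_neq0 ?denom_ratioP //.
by apply/eqP; ring.
Qed.

Lemma frac_div_repr p q : q != 0 ->
  let f := p%:F / q%:F in p * denom f = numer f * q.
Proof.
move=> q0 f; have d0 := denom_ratioP (repr f).
apply/eqP; rewrite -tofrac_eq !tofracM; apply/eqP.
have/eqP := fracE f; rewrite {1}/f eqr_div ?tofrac_eq0 // => /eqP ->.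
by [].
Qed.

Lemma ratderivE p q : q != 0 ->
  ratderiv (p%:F / q%:F) = (p^`() * q - p * q^`())%:F / (q ^+ 2)%:F.
Proof.
move=> q0; have := frac_div_repr p q0; rewrite /ratderiv /=.
set f := p%:F / q%:F; have d0 := denom_ratioP (repr f).
move: d0; set d := denom f; set n := numer f => d0 E1.
have E2 : p^`() * d + p * d^`() = n^`() * q + n * q^`().
  by rewrite -!derivM E1.
apply/eqP; rewrite eqr_div ?tofrac_eq0 ?expf_neq0 // -!tofracM tofrac_eq.
rewrite -subr_eq0; apply/eqP; transitivity
  (d * q * ((n^`() * q + n * q^`()) - (p^`() * d + p * d^`()))
   - (d * q^`() + d^`() * q) * (n * q - p * d)); first by ring.
by rewrite E1 E2 !subrr !mulr0 subrr.
Qed.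

Lemma rateval_div p q z : q.[z] != 0 ->
  rateval (p%:F / q%:F) z = p.[z] / q.[z].
Proof.
move=> qz; have q0 : q != 0 by apply: contraNneq qz => ->; rewrite horner0.
have := frac_div_repr p q0; rewrite /rateval /ratnum /ratden /=.
set f := p%:F / q%:F; have d0 := denom_ratioP (repr f).
move: d0; set d := denom f; set n := numer f => d0 E.
have g0 : gcdp n d != 0 by rewrite gcdp_eq0 negb_and d0 orbT.
have cop : coprimep (d %/ gcdp n d) (n %/ gcdp n d).
  by rewrite coprimep_sym coprimep_div_gcd // d0 orbT.
have {}E : p * (d %/ gcdp n d) = n %/ gcdp n d * q.
  apply: (mulIf g0); rewrite -mulrA divpK ?dvdp_gcdr // E.
  by rewrite mulrAC divpK ?dvdp_gcdl.
have dz : (d %/ gcdp n d).[z] != 0.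
  have : d %/ gcdp n d %| q.
    by rewrite -(Gauss_dvdpr _ cop) -E dvdp_mull.
  by move=> /dvdpP[c qE]; apply: contraNneq qz => dz; rewrite qE hornerM dz mulr0.
by apply/eqP; rewrite eqr_div // -!hornerM E.
Qed.

Definition common_denominator (n : nat) (A : 'M[KX]_n) (Delta : {poly K}) :=
  Delta != 0 /\ forall i j, exists b : {poly K}, Delta%:F * A i j = b%:F.

(* A_1 = A and A_(m+1) = dA_m/dz + A_m A; the value at m = 0 follows the
   convention A_0 = 1, which is consistent with the recursion. *)
Fixpoint iterA (n : nat) (A : 'M[KX]_n) (m : nat) : 'M[KX]_n :=
  match m with
  | 0 => 1%:M
  | 1 => A
  | m'.+1 => map_mx ratderiv (iterA A m') + iterA A m' *m A
  end.

End RationalFunctions.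

Definition evalmx (K : fieldType) (m n : nat) (A : 'M[{fraction {poly K}}]_(m, n))
  (z : K) : 'M[K]_(m, n) := map_mx (fun f => rateval f z) A.

(* S is the subring (= Z-subalgebra) generated by a finite sequence s. *)
Definition finitely_generated (K : nzRingType) (S : subringClosed K) : Prop :=
  exists s : seq K, {subset s <= S} /\
    forall T : subringClosed K, {subset s <= T} -> {subset S <= T}.

(* Membership in S[1/N], seen inside the field K (meant for N != 0). *)
Definition in_localization (K : fieldType) (S : {pred K}) (N x : K) : Prop :=
  exists2 a : K, a \in S & exists j : nat, x = a / N ^+ j.

(* x is an element of S[1/N] whose class in S[1/N] / c S[1/N] is zero. *)
Definition zero_modulo (K : fieldType) (S : {pred K}) (N c x : K) : Prop :=
  in_localization S N x /\ exists2 b : K, in_localization S N b & x = c * b.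

Section Solutions.
Variable K : numFieldType.
Local Notation KX := {fraction {poly K}}.

Definition holomorphic_near (g : K -> K) (z0 : K) : Prop :=
  \forall z \near z0, derivable g z 1.

Definition is_solution (n : nat) (A : 'M[KX]_n) (z0 : K) (y0 : 'cV[K]_n)
    (y : 'I_n -> K -> K) : Prop :=
  [/\ forall i, holomorphic_near (y i) z0,
      forall i, \forall z \near z0,
        (y i)^`() z = (evalmx A z *m (\col_j y j z)) i 0
    & forall i, y i z0 = y0 i 0].

(* Algebraicity over K(z) of the germ at z0 of g.  The coefficients may have a
   pole at z0, so the equation is required on a punctured neighbourhood, i.e.
   in the field of germs of meromorphic functions. *)
Definition algebraic_near (g : K -> K) (z0 : K) : Prop :=
  exists2 P : {poly KX}, P != 0 &
    \forall z \near z0^', \sum_(k < size P) rateval P`_k z * g z ^+ k = 0.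

End Solutions.

(* Main.v *)
Require Import Defs.
From HB Require Import structures.
From mathcomp Require Import all_boot all_order all_algebra ring zify.
From mathcomp Require Import complex fraction.
From mathcomp Require Import all_classical all_reals all_analysis.
Import Order.TTheory GRing.Theory Num.Theory.
Import numFieldNormedType.Exports.
Local Open Scope ring_scope.

Set Implicit Arguments.
Unset Strict Implicit.
Unset Printing Implicit Defensive.

(** Differentiating y' = A y repeatedly gives y^(m) = A_m y, so the vectors
    a_m = A_m(z0) y0 / m! are the Taylor coefficients of y at z0.  Moreover
    A_m = B_m / Delta^m for a polynomial matrix B_m over S, hence a_m has
    entries in the fraction field of S.  What has to be shown is therefore
    Eisenstein's theorem over S: if a power series with coefficients in Frac S
    and constant term in S is algebraic over the rational functions, then some
    nonzero N in S satisfies N^m a_m \in S for all m.  The product of these N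
    over the entries of y serves all of them, and dividing m! by p^k gives the
    statement modulo p^k.

    From functions to power series.  Taking Taylor coefficients at z0 is a ring
    morphism, by the Leibniz rule alone, and it kills germs that vanish; so an
    algebraic equation P(z, y(z)) = 0 near z0 becomes an identity of formal
    power series, with no convergence argument ([has_jet_eq0],
    [algebraic_near_annihilator]).  A power series is represented by its
    sequence of coefficients, and an identity P(X, y) = 0 by the divisibility
    of P(X, y mod X^M) by X^M for every M ([annihilates]).

    From the complex numbers to S.  For fixed degrees, the equation
    P(X, y) = 0 is a system of linear equations over Frac S in the coefficients
    of P, so a nonzero solution over a larger field yields one over Frac S
    ([linear_relation_descent]), thus one over S after clearing denominators.
    Replacing P by its derivatives in Y as long as they annihilate y, one may
    assume that P_Y(X, y) is not zero ([separable_annihilator]).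

    Eisenstein's theorem.  Let r be the order of P_Y(X, y) and u the truncation
    of y after X^r.  Writing y = u + X^r v and dividing P(X, u + X^r v) by
    X^(2r), one obtains an equation H(X, v) = 0 for which v(0) = 0 is a simple
    root modulo X, that is e = H_V(0, 0) is not zero
    ([separable_annihilator_denominators]).  The substitution X -> e^2 X,
    V -> e V makes all terms divisible by e^2, and after division the linear
    term is V times a polynomial with constant term 1
    ([simple_root_denominators]); the equation then computes each coefficient of
    the new series from the preceding ones without any division
    ([integral_fixpoint]). *)

(** * Algebraic power series and their denominators *)

Section AlgebraicSeries.
Variable K : fieldType.
Implicit Types (p q : {poly K}) (P Q H R : {poly {poly K}}) (a : nat -> K).

Lemma dvdp_XnP M p : reflect (forall k, (k < M)%N -> p`_k = 0) ('X^M %| p).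
Proof.
apply: (iffP idP) => [/dvdpP[q ->] k ltkM | p0].
  by rewrite coefMXn ltkM.
rewrite -(poly_take_drop M p) (_ : take_poly M p = 0) ?add0r ?dvdp_mulIr //.
by apply/polyP => k; rewrite coef_take_poly coef0; case: ifP => // /p0.
Qed.

(** Factor theorem for the polynomial P - P(q), which has the root q. *)
Lemma dvdp_horner_sub P p q : p - q %| P.[p] - P.[q].
Proof.
have : root (P - (P.[q])%:P) q by rewrite rootE !hornerE subrr.
case/factor_theorem => G defG.
have -> : P.[p] - P.[q] = (P - (P.[q])%:P).[p] by rewrite !hornerE.
by rewrite defG hornerM hornerXsubC dvdp_mulIr.
Qed.

Definition trunc a (M : nat) : {poly K} := \poly_(k < M) a k.

(** The identity P(X, y) = 0 in the ring of formal power series, for the series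
    y whose coefficients are the values of a. *)
Definition annihilates P a := forall M, 'X^M %| P.[trunc a M].

Lemma dvdp_trunc_sub a M M' : (M <= M')%N -> 'X^M %| trunc a M' - trunc a M.
Proof.
move=> leM; apply/dvdp_XnP => k ltk.
by rewrite coefB !coef_poly ltk (leq_trans ltk leM) subrr.
Qed.

Lemma dvdp_horner_trunc P a M M' : (M <= M')%N ->
  ('X^M %| P.[trunc a M']) = ('X^M %| P.[trunc a M]).
Proof.
move=> leM; rewrite -[P.[trunc a M']](subrK P.[trunc a M]).
by rewrite dvdp_addr // (dvdp_trans (dvdp_trunc_sub a leM)) // dvdp_horner_sub.
Qed.

Lemma taylor2 P p h : exists g, P.[p + h] = P.[p] + P^`().[p] * h + g * h ^+ 2.
Proof.
have cph : GRing.comm p h by exact: mulrC.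
rewrite (nderiv_taylor_wide cph (leq_trans (leqnSn _) (leqnSn _))).
rewrite !big_ord_recl nderivn0 nderivn1 expr0 mulr1 expr1 addrA.
exists (\sum_(i < size P) P^`N(i.+2).[p] * h ^+ i).
congr (_ + _); rewrite mulr_suml; apply: eq_bigr => i _.
by rewrite -mulrA -exprD addn2.
Qed.

Section Integrality.
Variable S : subringClosed K.

Lemma coef2_over P : P \is a polyOver (polyOver S) -> forall i k, P`_i`_k \in S.
Proof. by move=> /polyOverP PS i k; have /polyOverP := PS i; apply. Qed.

Lemma horner2_over P p : P \is a polyOver (polyOver S) -> p \is a polyOver S ->
  P.[p] \is a polyOver S.
Proof. by move=> PS pS; apply: rpred_horner. Qed.

(** The equation w = - R(X, w) determines w: since w has no constant term and
    the coefficient of W in R is divisible by X, the m-th coefficient of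
    R(X, w) involves only the coefficients of w of index less than m. *)
Lemma integral_fixpoint R w : R \is a polyOver (polyOver S) -> R`_1`_0 = 0 ->
  w 0 = 0 -> annihilates ('X + R) w -> forall m, w m \in S.
Proof.
move=> RS R10 w0 annR m; elim/ltn_ind: m => -[|m] IH; first by rewrite w0 rpred0.
(* Compare R at the truncations W and W + h: by Taylor's formula the values
   agree modulo X^(m+2). *)
set W := trunc w m.+1; set h := (w m.+1)%:P * 'X^(m.+1) : {poly K}.
have defW : trunc w m.+2 = W + h.
  apply/polyP => k; rewrite coefD coefCM coefXn !coef_poly ltnS leq_eqVlt.
  by case: (ltngtP k m.+1) => [||->]; rewrite ?mulr0 ?mulr1 ?addr0 ?add0r.
have WS : W \is a polyOver S.
  by apply/polyOver_poly => k ltk; apply: IH.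
have h0 : 'X^(m.+1) %| h by rewrite dvdp_mulIr.
have W0 : 'X %| W.
  rewrite -['X]expr1; apply/dvdp_XnP => -[|//] _.
  by rewrite coef_poly w0.
have dW : 'X %| R^`().[W].
  have /(dvdp_trans W0) : W %| R^`().[W] - R^`().[0].
    by rewrite -{1}[W]subr0 dvdp_horner_sub.
  suff R'0 : 'X %| R^`().[0] by rewrite dvdp_subl.
  rewrite horner_coef0 coef_deriv mulr1n -['X]expr1.
  by apply/dvdp_XnP => -[|//] _.
have := annR m.+2; rewrite defW hornerD hornerX.
have [g ->] := taylor2 R W h.
have dh1 : 'X^(m.+2) %| R^`().[W] * h by rewrite exprS dvdp_mul.
have dh2 : 'X^(m.+2) %| g * h ^+ 2.
  apply: dvdp_mull; apply: (dvdp_trans _ (dvdp_mul h0 h0)).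
  by rewrite -exprD dvdp_exp2l // addSn ltnS leq_addl.
rewrite !addrA dvdp_addl // dvdp_addl // => /dvdp_XnP/(_ m.+1 (ltnSn _)).
rewrite !coefD coefCM coefXn eqxx mulr1 coef_poly ltnn add0r => /eqP.
rewrite addr_eq0 => /eqP ->; rewrite rpredN.
by have /polyOverP := horner2_over RS WS; apply.
Qed.

(** Eisenstein's theorem at a simple root, with e = H_V(0, 0) as the source of
    all denominators: w(X) = v(e^2 X) / e is a solution of an equation to which
    [integral_fixpoint] applies. *)
Lemma simple_root_denominators H v : H \is a polyOver (polyOver S) ->
  H`_1`_0 != 0 -> v 0 = 0 -> annihilates H v ->
  forall m, H`_1`_0 ^+ m.*2 * v m \in S.
Proof.
set e := H`_1`_0 => HS e0 v0 annH m.
have HSc i k : H`_i`_k \in S by exact: coef2_over.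
have eS : e \in S by exact: HSc.
pose s : {poly K} -> {poly K} := comp_poly (e ^+ 2 *: 'X).
have sE p k : (s p)`_k = e ^+ k.*2 * p`_k.
  rewrite /s comp_polyE coef_sum.
  under eq_bigr => i _ do rewrite exprZn -exprM mul2n scalerA coefZ coefXn.
  have [ltk|lek] := ltnP k (size p); last first.
    rewrite (nth_default _ lek) mulr0 big1 // => i _.
    by rewrite gtn_eqF ?mulr0 // (leq_trans (ltn_ord i)).
  rewrite (bigD1 (Ordinal ltk)) //= eqxx mulr1 mulrC big1 ?addr0 // => i.
  by rewrite -val_eqE /= eq_sym => /negPf ->; rewrite mulr0.
(* R is chosen so that 'X + R is e^-2 H(e^2 X, e V): its coefficients lie in S
   since h_00 = 0, h_10 = e and all other monomials acquire a factor e^2. *)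
pose R := (e ^- 2)%:P *: (map_poly s H \Po (e%:P *: 'X)) - 'X : {poly {poly K}}.
have s0 : s 0 = 0 by rewrite /s comp_poly0.
have RE i k : R`_i`_k =
    e ^- 2 * (e ^+ (i + k.*2) * H`_i`_k) - ((i == 1) && (k == 0))%:R.
  rewrite /R coefB coefZ coefX coefB coefCM.
  have -> : (map_poly s H \Po (e%:P *: 'X))`_i = (e ^+ i)%:P * s H`_i.
    rewrite comp_polyE coef_sum.
    under eq_bigr => j _ do rewrite exprZn scalerA coefZ coefXn -polyC_exp.
    have [lti|lei] := ltnP i (size (map_poly s H)); last first.
      rewrite -coef_map_id0 // (nth_default _ lei) mulr0 big1 // => j _.
      by rewrite gtn_eqF ?mulr0 // (leq_trans (ltn_ord j)).
    rewrite (bigD1 (Ordinal lti)) //= eqxx mulr1 coef_map_id0 // mulrC.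
    rewrite big1 ?addr0 // => j.
    by rewrite -val_eqE /= eq_sym => /negPf ->; rewrite mulr0.
  rewrite coefCM sE mulrA exprD !mulrA; congr (_ - _).
  by case: (i == 1); rewrite ?coef1 ?coef0.
have H00 : H`_0`_0 = 0.
  have := annH 1%N; rewrite /trunc poly_def big_ord1 v0 scale0r horner_coef0.
  by move/dvdp_XnP/(_ 0%N isT).
have R10 : R`_1`_0 = 0.
  by rewrite RE /= addn0 expr1 -expr2 mulVf ?subrr // expf_neq0.
have RS : R \is a polyOver (polyOver S).
  apply/polyOverP => i; apply/polyOverP => k.
  have [lt2|] := leqP 2 (i + k.*2).
    rewrite RE rpredB ?rpred_nat // -(subnKC lt2) exprD mulrA mulKf ?expf_neq0 //.
    by rewrite rpredM ?rpredX.
  case: i => [|[|i]] //; case: k => [|k] // _; last by rewrite R10 rpred0.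
  by rewrite RE H00 !mulr0 subr0 rpred0.
pose w j := e ^+ j.*2 / e * v j.
have annR : annihilates ('X + R) w.
  move=> M; rewrite /R addrC subrK hornerZ horner_comp hornerZ hornerX.
  have -> : e%:P * trunc w M = s (trunc v M).
    apply/polyP => k; rewrite coefCM sE !coef_poly.
    case: ifP => _; rewrite ?mulr0 //.
    by rewrite /w mulrA mulrCA divff ?mulr1.
  rewrite horner_map dvdp_mull //=; have /dvdpP[q ->] := annH M.
  rewrite rmorphM rmorphXn /= /s comp_polyX exprZn -scalerAr.
  by rewrite dvdpZr ?expf_neq0 ?dvdp_mull.
have := integral_fixpoint RS R10 _ annR m; rewrite /w v0 mulr0 => /(_ erefl).
by move/(rpredM eS); rewrite mulrA mulrCA divff ?mulr1.
Qed.

(** The fraction field of S, as a subset of K. *)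
Definition fractions : {pred K} :=
  fun x => `[< exists b, [/\ b \in S, b != 0 & b * x \in S] >].

Lemma fractionsP x :
  reflect (exists b, [/\ b \in S, b != 0 & b * x \in S]) (x \in fractions).
Proof. exact: asboolP. Qed.

Lemma mem_fractions x : x \in S -> x \in fractions.
Proof.
by move=> xS; apply/fractionsP; exists 1; rewrite rpred1 oner_neq0 mul1r.
Qed.

Lemma fractions_divring_closed : divring_closed fractions.
Proof.
split=> [|x z|x z]; first exact/mem_fractions/rpred1.
  move=> /fractionsP[b [bS b0 bx]] /fractionsP[c [cS c0 cz]].
  apply/fractionsP; exists (b * c); split; [exact: rpredM | exact: mulf_neq0 |].
  have -> : b * c * (x - z) = c * (b * x) - b * (c * z) by ring.
  by apply: rpredB; exact: rpredM.
move=> /fractionsP[b [bS b0 bx]] /fractionsP[c [cS c0 cz]].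
have [->|z0] := eqVneq z 0.
  by rewrite invr0 mulr0; exact/mem_fractions/rpred0.
apply/fractionsP; exists (b * (c * z)).
split; [exact: rpredM | by rewrite !mulf_neq0 |].
have -> : b * (c * z) * (x / z) = c * (b * x) by field.
exact: rpredM.
Qed.

HB.instance Definition _ :=
  GRing.isDivringClosed.Build K fractions fractions_divring_closed.

Lemma fractions_common_denominator (I : eqType) (r : seq I) (f : I -> K) :
  (forall i, i \in r -> f i \in fractions) ->
  exists b, [/\ b \in S, b != 0 & forall i, i \in r -> b * f i \in S].
Proof.
elim: r => [|i r IH] fr; first by exists 1; rewrite rpred1 oner_neq0.
have [j rj|b [bS b0 bf]] := IH; first by apply: fr; rewrite inE rj orbT.
have /fractionsP[c [cS c0 cf]] := fr i (mem_head _ _).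
exists (c * b); split; [exact: rpredM | exact: mulf_neq0 | move=> j].
rewrite inE => /predU1P[->|/bf bfj]; last by rewrite -mulrA rpredM.
by rewrite mulrAC rpredM.
Qed.

(** The factor b^i clears the denominators of p^i, and only i < D occur. *)
Lemma clear_horner P p b D : P \is a polyOver (polyOver S) -> b \in S ->
  b *: p \is a polyOver S -> (size P <= D)%N -> b ^+ D *: P.[p] \is a polyOver S.
Proof.
move=> PS bS bpS leD; rewrite (horner_coef_wide p leD) scaler_sumr.
rewrite rpred_sum // => i _.
have -> : b ^+ D *: (P`_i * p ^+ i) = b ^+ (D - i) *: (P`_i * (b *: p) ^+ i).
  rewrite exprZn -!scalerAr scalerA -exprD subnK //; exact: ltnW.
by rewrite polyOverZ ?rpredX // rpredM ?rpredX // (polyOverP PS).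
Qed.

(** Newton's method reduces a series y with P_Y(X, y) <> 0 to a simple root.
    With r the order of P_Y(X, y) and u = y mod X^(r+1), Taylor's formula reads
    P(X, u + X^r V) = P(X, u) + X^r P_Y(X, u) V + X^(2r) (...), where P_Y(X, u)
    still has order exactly r; P(X, u) is divisible by X^(2r) because the other
    terms are and the sum vanishes at V = v. *)
Lemma separable_annihilator_denominators P a :
    P \is a polyOver (polyOver S) -> annihilates P a ->
    ~ annihilates P^`() a -> (forall m, a m \in fractions) -> a 0 \in S ->
  exists N, [/\ N \in S, N != 0 & forall m, N ^+ m * a m \in S].
Proof.
move=> PS annP nannP' aF a0S.
have exM : exists M, ~~ ('X^M %| P^`().[trunc a M]).
  by apply/not_existsP => nM; apply: nannP' => M; apply/negPn/negP/nM.
case: (ex_minnP exM) => -[|r] ndvd minr; first by rewrite expr0 dvd1p in ndvd.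
have dvdr : 'X^r %| P^`().[trunc a r].
  by apply/negPn/negP => /minr; rewrite ltnn.
set u := trunc a r.+1 in ndvd.
have {}dvdr : 'X^r %| P^`().[u] by rewrite (dvdp_horner_trunc _ _ (leqnSn r)).
have [|b [bS b0 ba]] := @fractions_common_denominator _ (iota 0 r.+1) a.
  by move=> i _; exact: aF.
have buS : b *: u \is a polyOver S.
  apply/polyOverP => k; rewrite coefZ coef_poly; case: ifP => ltk.
    by apply: ba; rewrite mem_iota.
  by rewrite mulr0 rpred0.
set D := size P.
(* The coefficients of b^D P(X, u + X^r V) in V, by Taylor's formula. *)
pose c i := (b ^+ D *: P^`N(i).[u]) * 'X^(r * i).
have cS i : c i \is a polyOver S.
  rewrite /c rpredM ?rpredX ?polyOverX // clear_horner //.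
    exact: polyOver_nderivn.
  apply/leq_sizeP => j leDj; rewrite coef_nderivn nth_default ?mul0rn //.
  exact: leq_trans leDj (leq_addl _ _).
pose v j := if j is j'.+1 then a (r + j) else 0.
have truncE M : trunc a (r + M.+1) = u + 'X^r * trunc v M.+1.
  apply/polyP => k; rewrite coefD coefXnM !coef_poly.
  case: (ltngtP k r) => [ltk|ltk|->].
  - by rewrite ltn_addr // ltnS ltnW // addr0.
  - have [j ->] : exists j, k = (r + j.+1)%N by exists (k - r.+1)%N; lia.
    have -> : (r + j.+1 < r.+1)%N = false by lia.
    by rewrite addKn ltn_add2l add0r.
  - by rewrite ltnSn subnn addr0 -addSnnS ltn_addr.
have taylorE M : b ^+ D *: P.[trunc a (r + M.+1)]
    = \sum_(i < D.+1) c i * trunc v M.+1 ^+ i.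
  rewrite truncE (@nderiv_taylor_wide _ D.+1) //; last exact: mulrC.
  rewrite scaler_sumr; apply: eq_bigr => i _.
  by rewrite /c exprMn -exprM mulrA -!scalerAl.
have dvdc i : 'X^(r * 2) %| c i.
  have dvdcS j : 'X^(r * 2) %| c j.+1.
    case: j => [|j]; last by rewrite dvdp_mull // dvdp_exp2l // leq_mul2l orbT.
    by rewrite /c nderivn1 muln1 muln2 -addnn exprD dvdp_mul // dvdpZr ?expf_neq0.
  case: i => [|i] //; have := taylorE r; rewrite big_ord_recl expr0 mulr1.
  set rest := \sum_(i < D) _ => eq_c0.
  have dvd_rest : 'X^(r * 2) %| rest.
    by apply: (big_ind (fun p => 'X^(r * 2) %| p)) => [|p q|j _];
      [exact: dvdp0 | exact: dvdp_add | exact/dvdp_mulr/dvdcS].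
  rewrite -(dvdp_addl (c 0) dvd_rest) -eq_c0 dvdpZr ?expf_neq0 //.
  apply: dvdp_trans (annP (r + r.+1)%N).
  by rewrite dvdp_exp2l // addnS muln2 -addnn.
pose H := \poly_(i < D.+1) drop_poly (r * 2) (c i).
have HE p : 'X^(r * 2) * H.[p] = \sum_(i < D.+1) c i * p ^+ i.
  rewrite (horner_coef_wide p (size_poly _ _)) mulr_sumr; apply: eq_bigr => i _.
  rewrite coef_poly ltn_ord mulrA; congr (_ * _).
  by have /dvdpP[q ->] := dvdc i; rewrite drop_polyMXn_id mulrC.
have HS : H \is a polyOver (polyOver S).
  apply/polyOver_poly => i _; apply/polyOverP => k.
  by rewrite coef_drop_poly (polyOverP (cS i)).
have D0 : (0 < D)%N.
  rewrite lt0n size_poly_eq0; apply: contraNneq ndvd => ->.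
  by rewrite deriv0 horner0 dvdp0.
have H10 : H`_1`_0 != 0.
  rewrite coef_poly ltnS D0 coef_drop_poly add0n /c nderivn1 muln1 coefMXn.
  rewrite muln2 -addnn ltnNge leq_addr /= addnK coefZ mulf_neq0 ?expf_neq0 //.
  apply: contra ndvd => /eqP d0; apply/dvdp_XnP => k.
  by rewrite ltnS leq_eqVlt => /predU1P[->//|]; apply/dvdp_XnP: k.
have annH : annihilates H v.
  case=> [|M]; first by rewrite expr0 dvd1p.
  rewrite -(@dvdp_horner_trunc _ _ _ (r + M).+1) ?ltnS ?leq_addl //.
  have X0 : 'X^(r * 2) != 0 :> {poly K} by rewrite expf_neq0 ?polyX_eq0.
  rewrite -(dvdp_mul2l _ _ X0) HE -taylorE -exprD dvdpZr ?expf_neq0 //.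
  by have := annP (r + (r + M).+1)%N; rewrite muln2 -addnn -addnA !addnS.
have vS := simple_root_denominators HS H10 (erefl _) annH.
have eS : H`_1`_0 \in S by exact: coef2_over.
(* The factor b takes care of a 1, ..., a r, and e^2 of the v m = a (r + m). *)
exists (b * H`_1`_0 ^+ 2); split;
  [by rewrite rpredM ?rpredX | by rewrite mulf_neq0 ?expf_neq0 |].
case=> [|m]; first by rewrite mul1r.
have [lem|ltm] := leqP m.+1 r.
  rewrite exprMn mulrAC rpredM ?rpredX // exprSr -mulrA.
  apply: rpredM; first exact: rpredX.
  by apply: ba; rewrite mem_iota.
have -> : m.+1 = (r + (m - r).+1)%N by lia.
rewrite exprMn -exprM mul2n -mulrA; apply: rpredM; first exact: rpredX.
rewrite doubleD exprD -mulrA; apply: rpredM; first exact: rpredX.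
exact: (vS (m - r).+1).
Qed.

(** Induction on the number of variables.  If c i is an F-combination of the
    other coefficients, substituting it leaves a linear form in fewer variables;
    otherwise every F-rational zero x of the form has x i = 0, and one can take
    d to be the i-th coordinate. *)
Lemma linear_relation_descent (F : divringClosed K) (I : eqType) (r : seq I)
    (c : I -> K) : uniq r -> has (fun i => c i != 0) r ->
  exists d : I -> K, [/\ forall i, d i \in F, has (fun i => d i != 0) r
    & forall x : I -> K, (forall i, x i \in F) ->
      \sum_(i <- r) c i * x i = 0 -> \sum_(i <- r) d i * x i = 0].
Proof.
elim: r => [|i r IH] //= /andP[ir ur] cn0.
have [[mu [muF ci]]|nspan] :=
  pselect (exists mu : I -> K,
    (forall j, mu j \in F) /\ c i = \sum_(j <- r) c j * mu j).
  have [|d [dF dn0 dx]] := IH ur.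
    case: (boolP (has _ r)) cn0 => // /hasPn c0; rewrite orbF => /eqP[].
    rewrite ci big_seq big1 // => j /c0 /=.
    by rewrite negbK => /eqP->; rewrite mul0r.
  pose d' j := if j == i then \sum_(j <- r) d j * mu j else d j.
  have d'r j : j \in r -> d' j = d j.
    by move=> jr; rewrite /d'; case: eqP => // ji; rewrite -ji jr in ir.
  exists d'; split=> [j||x xF].
  - by rewrite /d'; case: eqP => // _; rewrite rpred_sum // => k _; rewrite rpredM.
  - case/hasP: dn0 => j jr dj; apply/orP; right; apply/hasP; exists j => //.
    by rewrite d'r.
  - rewrite !big_cons ci => cx.
    have := dx (fun j => mu j * x i + x j); rewrite /d' eqxx.
    have sumE (f : I -> K) : \sum_(j <- r) f j * (mu j * x i + x j) =
        (\sum_(j <- r) f j * mu j) * x i + \sum_(j <- r) f j * x j.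
      rewrite mulr_suml -big_split; apply: eq_bigr => j _ /=.
      by rewrite mulrDr mulrA.
    rewrite !sumE cx => dx0.
    rewrite -[RHS]dx0 //; last by move=> j; rewrite rpredD ?rpredM.
    by congr (_ + _); apply: eq_big_seq => j /d'r; rewrite /d' => ->.
exists (fun j => (j == i)%:R); split=> [j||x xF]; first exact: rpred_nat.
  by rewrite eqxx oner_neq0.
rewrite !big_cons eqxx mul1r => cx.
rewrite big_seq big1 => [|j jr]; last first.
  by case: eqP => [ji|_]; rewrite ?mul0r //; rewrite -ji jr in ir.
rewrite addr0.
apply/eqP/negPn/negP => xi0; apply: nspan.
exists (fun j => - (x j / x i)); split=> [j|]; first by rewrite rpredN rpred_div.
move/eqP: cx; rewrite addr_eq0 => /eqP cx; apply: (mulIf xi0); rewrite cx.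
rewrite mulr_suml -sumrN; apply: eq_bigr => j _.
by rewrite -mulrA mulNr mulrN divfK.
Qed.

(** Each coefficient of P(X, p) is a linear form in the coefficients of P, whose
    own coefficients are polynomials in those of p. *)
Lemma coef_horner2 P p (l s D : nat) : (size P <= s)%N ->
    (forall i : nat, (size (P`_i)%R <= D)%N) ->
  P.[p]`_l = \sum_(ij <- [seq (i, j) | i <- index_iota 0 s, j <- index_iota 0 D])
    P`_(ij.1)`_(ij.2) * ('X^(ij.2) * p ^+ ij.1)`_l.
Proof.
move=> les leD; rewrite big_allpairs big_mkord.
rewrite (horner_coef_wide p les) coef_sum; apply: eq_bigr => i _.
have -> : P`_i = \sum_(j < D) P`_i`_j *: 'X^j.
  rewrite -poly_def; apply/polyP => j; rewrite coef_poly.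
  by case: ltnP => // /(leq_trans (leD i)) /(nth_default 0).
rewrite mulr_suml coef_sum big_mkord.
by apply: eq_bigr => j _; rewrite -scalerAl coefZ -poly_def coef_poly ltn_ord.
Qed.

Lemma annihilator_descent Q a : Q != 0 -> annihilates Q a ->
    (forall m, a m \in fractions) ->
  exists P, [/\ P != 0, P \is a polyOver (polyOver S) & annihilates P a].
Proof.
move=> Q0 annQ aF; set s := size Q; set D := (\max_(i < s) size (Q`_i)%R)%N.
have leD (i : nat) : (size (Q`_i)%R <= D)%N.
  have [lti|lei] := ltnP i s; last by rewrite nth_default // size_poly0.
  exact: (@leq_bigmax _ (fun i : 'I_s => size Q`_i) (Ordinal lti)).
set r := [seq (i, j) | i <- index_iota 0 s, j <- index_iota 0 D].
have mem_r i j : ((i, j) \in r) = (i < s)%N && (j < D)%N.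
  apply/allpairsP/andP => [[[i' j'] /= [+ + [-> ->]]]|[lti ltj]].
    by rewrite !mem_index_iota.
  by exists (i, j); rewrite !mem_index_iota.
have [||d [dF dn0 dx]]
  := @linear_relation_descent fractions _ r (fun ij => Q`_(ij.1)`_(ij.2)).
- by rewrite allpairs_uniq ?iota_uniq // => -[? ?] [].
- have Qs : Q`_s.-1 != 0 by rewrite -/(lead_coef Q) lead_coef_eq0.
  apply/hasP; exists (s.-1, (size Q`_s.-1).-1); last by rewrite /= lead_coef_eq0.
  have lt_pred m : (0 < m -> m.-1 < m)%N by case: m.
  rewrite mem_r lt_pred ?size_poly_gt0 // (leq_trans _ (leD s.-1)) //.
  by rewrite lt_pred ?size_poly_gt0.
have [b [bS b0 bd]] := @fractions_common_denominator _ r d (fun i _ => dF i).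
pose P := \poly_(i < s) \poly_(j < D) (b * d (i, j)).
have PE i j : (i, j) \in r -> P`_i`_j = b * d (i, j).
  by rewrite mem_r => /andP[lti ltj]; rewrite !coef_poly lti coef_poly ltj.
exists P; split.
- case/hasP: dn0 => -[i j] ijr; apply: contraNneq => P0.
  move: (PE _ _ ijr); rewrite P0 !coef0 => /esym/eqP; rewrite mulf_eq0 (negPf b0).
  by [].
- apply/polyOver_poly => i lti; apply/polyOver_poly => j ltj.
  by apply: bd; rewrite mem_r lti.
move=> M; apply/dvdp_XnP => l ltl.
have aMF : trunc a M \is a polyOver fractions by apply/polyOver_poly.
have leDP (i : nat) : (size (P`_i)%R <= D)%N.
  by rewrite coef_poly; case: ifP => _; rewrite ?size_poly ?size_poly0.
rewrite (@coef_horner2 P (trunc a M) l s D (size_poly _ _) leDP).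
have := dx (fun ij => ('X^(ij.2) * trunc a M ^+ ij.1)`_l).
rewrite -(@coef_horner2 Q (trunc a M) l s D (leqnn _) leD) => dx0.
rewrite (eq_big_seq (fun ij => b * (d ij * ('X^(ij.2) * trunc a M ^+ ij.1)`_l))).
  rewrite -mulr_sumr dx0 ?mulr0 //; last by move/dvdp_XnP: (annQ M); apply.
  move=> ij.
  suff /polyOverP : 'X^(ij.2) * trunc a M ^+ ij.1 \is a polyOver fractions by apply.
  by rewrite rpredM ?rpredX ?polyOverX.
by move=> [i j] /PE -> /=; rewrite mulrA.
Qed.

Hypothesis charK0 : [pchar K] =i pred0.

(** Take P of minimal degree in Y among the repeated derivatives that annihilate
    the series. *)
Lemma separable_annihilator P a : P != 0 -> P \is a polyOver (polyOver S) ->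
    annihilates P a ->
  exists P', [/\ P' \is a polyOver (polyOver S), annihilates P' a
    & ~ annihilates P'^`() a].
Proof.
elim: {P}_.+1 {-2}P (ltnSn (size P)) => // n IH P leP P0 PS annP.
have [annP'|] := pselect (annihilates P^`() a); last by exists P.
apply: (IH P^`()) annP'; last exact: polyOver_deriv.
  by rewrite -ltnS (leq_trans _ leP) // ltnS lt_size_deriv.
(* In characteristic 0, P_Y = 0 would mean that P is a nonzero polynomial in X
   alone, and such a polynomial is not divisible by every power of X. *)
apply/negP => /eqP/polyP P'0.
have defP : P = (P`_0)%:P.
  apply/polyP => -[|k]; rewrite coefC //=; have := P'0 k.
  rewrite coef_deriv coef0 -scaler_nat => /eqP; rewrite scaler_eq0.
  by have /pcharf0P -> := charK0 => /eqP.
have P00 : P`_0 != 0 by apply: contraNneq P0 => P00; rewrite defP P00.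
have := annP (size P`_0); rewrite [X in X.[_]]defP hornerC => /(dvdp_leq P00).
by rewrite size_polyXn ltnn.
Qed.

(** Eisenstein's theorem over S.  The equation has coefficients in K because an
    algebraic function is only known to satisfy one over the whole field. *)
Lemma algebraic_series_denominators Q a : Q != 0 -> annihilates Q a ->
    (forall m, a m \in fractions) -> a 0 \in S ->
  exists N, [/\ N \in S, N != 0 & forall m, N ^+ m * a m \in S].
Proof.
move=> Q0 annQ aF a0S.
have [P [P0 PS annP]] := annihilator_descent Q0 annQ aF.
have [P' [P'S annP' nannP']] := separable_annihilator P0 PS annP.
exact: separable_annihilator_denominators annP' nannP' aF a0S.
Qed.

End Integrality.
End AlgebraicSeries.

(** * Taylor coefficients of functions *)

Section Jets.
Variable K : numFieldType.
Implicit Types (f g : K -> K) (p q : {poly K}).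

Lemma is_derive_mul f g (z df dg : K) :
  is_derive z 1 f df -> is_derive z 1 g dg ->
  is_derive z 1 (fun x => f x * g x) (df * g z + f z * dg).
Proof.
move=> fd gd; apply: (is_derive_eq (is_deriveM fd gd)).
by rewrite addrC [df * _]mulrC.
Qed.

Lemma is_derive_bigsum n (h : 'I_n -> K -> K) (z : K) (dh : 'I_n -> K) :
  (forall i, is_derive z 1 (h i) (dh i)) ->
  is_derive z 1 (fun x => \sum_(i < n) h i x) (\sum_(i < n) dh i).
Proof.
move=> hd; have -> : (fun x => \sum_(i < n) h i x) = \sum_(i < n) h i.
  by apply/funext => x; rewrite fct_sumE.
exact: is_derive_sum.
Qed.

Lemma is_derive_horner p (z : K) : is_derive z 1 (horner p) p^`().[z].
Proof.
elim/poly_ind: p => [|p c IH].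
  rewrite deriv0 horner0 (_ : horner 0 = cst 0); first exact: is_derive_cst.
  by apply/funext => x; rewrite horner0.
have -> : horner (p * 'X + c%:P) = (fun x => p.[x] * x) + (cst c : K -> K).
  by apply/funext => x; rewrite hornerMXaddC.
have d1 := is_derive_mul IH (is_derive_id z 1).
apply: (is_derive_eq (is_deriveD d1 (is_derive_cst c z 1))).
by rewrite derivMXaddC hornerD hornerMX mulr1 addr0 addrC.
Qed.

(** F m stands for f^(m) / m!.  Dividing by m! turns the Leibniz rule into the
    Cauchy product, which is the product of polynomials. *)
Definition divided_derivatives (z0 : K) (F : nat -> K -> K) :=
  forall m : nat, \forall z \near z0,
    is_derive (z : K) (1 : K) (F m) (m.+1%:R * F m.+1 z).

(** p holds the Taylor coefficients of f at z0 up to X^(M-1), where X = z - z0;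
    the coefficients of p from X^M on are arbitrary. *)
Definition has_jet (z0 : K) (M : nat) f p := exists F, [/\ forall z, F 0 z = f z,
  divided_derivatives z0 F & forall m, (m < M)%N -> F m z0 = p`_m].

Lemma has_jet_cst (z0 : K) M (c : K) : has_jet z0 M (fun=> c) c%:P.
Proof.
exists (fun m => if m == 0 then cst c else cst 0); split=> // m.
  near=> z; apply: is_derive_eq; last by rewrite mulr0.
  by case: eqP => _; exact: is_derive_cst.
by rewrite coefC; case: eqP.
Unshelve. all: by end_near. Qed.

Lemma has_jet_id (z0 : K) M : has_jet z0 M id ('X + z0%:P).
Proof.
exists (fun m =>
  if m is m'.+1 then if m' is 0 then cst 1 else cst 0 else id); split=> // m.
  near=> z; case: m => [|[|m]].
  - by rewrite mulr1; exact: is_derive_id.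
  - by rewrite mulr0; exact: is_derive_cst.
  - by rewrite mulr0; exact: is_derive_cst.
by case: m => [|[|m]] _; rewrite coefD coefX coefC ?add0r ?addr0.
Unshelve. all: by end_near. Qed.

Lemma has_jetD (z0 : K) M f g p q : has_jet z0 M f p -> has_jet z0 M g q ->
  has_jet z0 M (fun z => f z + g z) (p + q).
Proof.
move=> [F [F0 dF Fp]] [G [G0 dG Gq]].
exists (fun m z => F m z + G m z); split=> [z|m|m ltm].
- by rewrite F0 G0.
- near=> z; rewrite mulrDr; apply: is_deriveD; first by near: z; exact: dF.
  by near: z; exact: dG.
- by rewrite coefD Fp ?Gq.
Unshelve. all: by end_near. Qed.

Lemma has_jetM (z0 : K) M f g p q : has_jet z0 M f p -> has_jet z0 M g q ->
  has_jet z0 M (fun z => f z * g z) (p * q).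
Proof.
move=> [F [F0 dF Fp]] [G [G0 dG Gq]].
exists (fun m z => \sum_(i < m.+1) F i z * G (m - i)%N z); split=> [z|m|m ltm].
- by rewrite big_ord1 F0 G0.
(* The derivative of the m-th Cauchy product is the sum of the terms
   i f_i g_(m+1-i) and (m+1-i) f_i g_(m+1-i), hence m+1 times the next one. *)
- have dFG (z : K) (d : forall i : 'I_m.+1,
    is_derive z 1 (F i) (i.+1%:R * F i.+1 z) /\
    is_derive z 1 (G (m - i)%N) ((m - i).+1%:R * G (m - i).+1 z)) :
    is_derive z 1 (fun x => \sum_(i < m.+1) F i x * G (m - i)%N x)
      (m.+1%:R * \sum_(i < m.+2) F i z * G (m.+1 - i)%N z).
    apply: is_derive_eq; first apply: is_derive_bigsum => i.
      by apply: is_derive_mul; [exact: (d i).1 | exact: (d i).2].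
    rewrite big_split /=.
    have -> : \sum_(i < m.+1) i.+1%:R * F i.+1 z * G (m - i)%N z =
        \sum_(i < m.+2) i%:R * (F i z * G (m.+1 - i)%N z).
      rewrite [RHS]big_ord_recl mul0r add0r; apply: eq_bigr => i _.
      by rewrite subSS mulrA.
    have -> : \sum_(i < m.+1) F i z * ((m - i).+1%:R * G (m - i).+1 z) =
        \sum_(i < m.+2) (m.+1 - i)%:R * (F i z * G (m.+1 - i)%N z).
      rewrite [RHS]big_ord_recr /= subnn mul0r addr0; apply: eq_bigr => i _.
      by rewrite subSn ?leq_ord // mulrCA.
    rewrite -big_split mulr_sumr; apply: eq_bigr => i _ /=.
    by rewrite -mulrDl -natrD subnKC // -ltnS.
  near=> z; apply: dFG; near: z; apply: filter_forall => i.
  by near=> z; split; near: z; [exact: dF | exact: dG].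
- rewrite coefM; apply: eq_bigr => i _.
  have lei : (i <= m)%N by rewrite -ltnS.
  by rewrite Fp ?Gq // (leq_ltn_trans _ ltm) // leq_subr.
Unshelve. all: by end_near. Qed.

Lemma eq_has_jet (z0 : K) M f g p : f =1 g -> has_jet z0 M f p -> has_jet z0 M g p.
Proof. by move=> /funext ->. Qed.

Lemma has_jet_horner (z0 : K) M p : has_jet z0 M (horner p) (p \Po ('X + z0%:P)).
Proof.
elim/poly_ind: p => [|p c IH].
  rewrite comp_poly0; apply: eq_has_jet (has_jet_cst z0 M 0) => z.
  by rewrite horner0.
rewrite comp_poly_MXaddC.
apply: eq_has_jet (has_jetD (has_jetM IH (has_jet_id z0 M)) (has_jet_cst z0 M c)).
by move=> z; rewrite hornerMXaddC.
Qed.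

(** The coefficients rewritten in the local parameter X = z - z0. *)
Definition recenter (z0 : K) : {poly {poly K}} -> {poly {poly K}} :=
  map_poly (comp_poly ('X + z0%:P)).

Lemma has_jet_horner2 (z0 : K) M f p (Q : {poly {poly K}}) : has_jet z0 M f p ->
  has_jet z0 M (fun z => Q.[(f z)%:P].[z]) (recenter z0 Q).[p].
Proof.
move=> fp; elim/poly_ind: Q => [|Q c IH].
  rewrite /recenter rmorph0 horner0; apply: eq_has_jet (has_jet_cst z0 M 0) => z.
  by rewrite !horner0.
rewrite /recenter rmorphD rmorphM /= map_polyX map_polyC /= hornerMXaddC.
apply: eq_has_jet (has_jetD (has_jetM IH fp) (has_jet_horner z0 M c)) => z.
by rewrite hornerMXaddC hornerD hornerM hornerC.
Qed.

(** A function that vanishes near z0 has all its derivatives equal to 0 near z0,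
    since each derivative depends only on the germ. *)
Lemma has_jet_eq0 (z0 : K) M f p : has_jet z0 M f p ->
  (\forall z \near z0, f z = 0) -> 'X^M %| p.
Proof.
move=> [F [F0 dF Fp]] f0; apply/dvdp_XnP => m /Fp <-.
suff: \forall z \near z0, F m z = 0 by exact: nbhs_singleton.
elim: m => [|m IH]; first by apply: filterS f0 => z; rewrite F0.
near=> z.
have Fm0 : \forall x \near z, F m x = 0.
  by near: z; exact: (near_join IH).
have dFm : is_derive z 1 (F m) (m.+1%:R * F m.+1 z) by near: z; exact: dF.
have d0 : is_derive z 1 (F m) 0.
  apply: near_eq_is_derive (is_derive_cst 0 z 1).
  by apply: filterS Fm0 => x.
apply/eqP; have := @derive_val _ _ _ _ _ _ _ dFm.
rewrite (@derive_val _ _ _ _ _ _ _ d0) => /esym/eqP.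
by rewrite mulf_eq0 pnatr_eq0.
Unshelve. all: by end_near. Qed.

End Jets.

(** * Equations with rational coefficients *)

Lemma clear_fractions (K : fieldType) (P : {poly {fraction {poly K}}}) :
  exists (D : {poly K}) (Q : {poly {poly K}}),
    D != 0 /\ forall k, tofrac D * P`_k = tofrac Q`_k.
Proof.
elim/poly_ind: P => [|P c [D [Q [D0 DP]]]].
  by exists 1, 0; split=> [|k]; rewrite ?oner_neq0 // !coef0 mulr0 tofrac0.
set n := (frac (repr c)).1; set d := (frac (repr c)).2.
have d0 : d != 0 by exact: denom_ratioP.
exists (D * d), (d%:P * Q * 'X + (D * n)%:P); split=> [|k].
  by rewrite mulf_neq0.
rewrite !coefD !coefMX !coefC; case: k => [|k] /=.
  rewrite !add0r {1}[c]fracE -/n -/d !tofracM -mulrA [tofrac d * _]mulrC.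
  by rewrite divfK ?tofrac_eq0.
by rewrite !addr0 coefCM !tofracM -DP mulrA [tofrac D * _]mulrC.
Qed.

Section AlgebraicGerms.
Variable K : numFieldType.

Lemma recenter_eq0 (z0 : K) Q : (recenter z0 Q == 0) = (Q == 0).
Proof.
have sz q : size (q \Po ('X + z0%:P)) = size q.
  by rewrite size_comp_poly2 // size_XaddC.
apply/eqP/eqP => [Q0|->]; last exact: rmorph0.
apply/polyP => k; apply/eqP; rewrite coef0 -size_poly_eq0 -sz size_poly_eq0.
by move/polyP/(_ k): Q0; rewrite coef_map coef0 => ->.
Qed.

(** Let D P = Q with Q over the ring of polynomials.  The function
    (z - z0) D(z) Q(z, g(z)) vanishes at every z near z0: the factor z - z0 takes
    care of z0 itself, where nothing is assumed, and the factor D(z) of the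
    poles of the coefficients of P. *)
Lemma algebraic_near_annihilator (g : K -> K) (z0 : K) (a : nat -> K) :
  (forall M, has_jet z0 M g (trunc a M)) -> algebraic_near g z0 ->
  exists2 Q : {poly {poly K}}, Q != 0 & annihilates Q a.
Proof.
move=> ga [P P0 Pg]; have [D [Q [D0 DP]]] := clear_fractions P.
have Q0 : Q != 0.
  apply: contraNneq P0 => Q0; apply/eqP/polyP => k; rewrite coef0.
  have /eqP := DP k; rewrite Q0 coef0 tofrac0 mulf_eq0 tofrac_eq0 (negPf D0).
  by move/eqP.
have leQP : (size Q <= size P)%N.
  apply/leq_sizeP => k lek; apply/eqP; rewrite -tofrac_eq0 -DP.
  by rewrite nth_default ?mulr0.
pose Q1 := (('X - z0%:P) * D)%:P * Q.
exists (recenter z0 Q1) => [|M].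
  by rewrite recenter_eq0 !mulf_neq0 // polyC_eq0 mulf_neq0 ?polyXsubC_eq0.
apply: has_jet_eq0 (has_jet_horner2 Q1 (ga M)) _.
move: Pg; rewrite /dnbhs near_withinE; apply: filterS => z Pg.
rewrite /Q1 hornerM hornerC !hornerM hornerXsubC.
have [->|zz0] := eqVneq z z0; first by rewrite subrr !mul0r.
have [->|Dz] := eqVneq D.[z] 0; first by rewrite mulr0 mul0r.
rewrite (horner_coef_wide _ leQP) horner_sum.
have -> : \sum_(k < size P) (Q`_k * (g z)%:P ^+ k).[z] =
    D.[z] * \sum_(k < size P) rateval P`_k z * g z ^+ k.
  rewrite mulr_sumr; apply: eq_bigr => k _.
  have -> : P`_k = tofrac Q`_k / tofrac D.
    by rewrite -DP mulrAC divff ?mul1r // tofrac_eq0.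
  by rewrite rateval_div // hornerM -polyC_exp hornerC mulrA [D.[z] * _]mulrC divfK.
by rewrite (Pg zz0) !mulr0.
Qed.

End AlgebraicGerms.

(** * The matrices A_m over their common denominator *)

Section IteratedDerivation.
Variables (K : fieldType) (n : nat) (A : 'M[{fraction {poly K}}]_n).
Variables (Delta : {poly K}) (B : 'M[{poly K}]_n).
Hypotheses (Delta0 : Delta != 0).
Hypothesis defB : forall i j, tofrac Delta * A i j = tofrac (B i j).

Lemma ratderivC (c : K) : ratderiv (tofrac c%:P) = 0.
Proof.
rewrite -[tofrac _]divr1 -tofrac1 ratderivE ?oner_neq0 //.
by rewrite derivC derivC mul0r mulr0 subrr tofrac0 mul0r.
Qed.

Lemma iterAS m : iterA A m.+1 = map_mx (@ratderiv K) (iterA A m) + iterA A m *m A.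
Proof.
case: m => //=; rewrite mul1mx -[LHS]add0r; congr (_ + _); apply/matrixP => i j.
rewrite !mxE; case: (i == j);
  by rewrite -?tofrac1 -?tofrac0 -?polyC1 -?polyC0 ratderivC tofrac0.
Qed.

(** The polynomial matrix Delta^m A_m: the recursion is that of A_m multiplied by
    Delta^(m+1), with B = Delta A. *)
Fixpoint iterA_numer (m : nat) : 'M[{poly K}]_n :=
  if m is m'.+1 then
    Delta *: map_mx (@deriv K) (iterA_numer m')
      - (Delta^`() *+ m') *: iterA_numer m' + iterA_numer m' *m B
  else 1%:M.

Lemma iterAE m i j :
  iterA A m i j = tofrac (iterA_numer m i j) / tofrac (Delta ^+ m).
Proof.
elim: m i j => [|m IH] i j.
  by rewrite /= !mxE tofrac1 divr1; case: (i == j); rewrite ?tofrac0 ?tofrac1.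
rewrite iterAS /= !mxE IH ratderivE ?expf_neq0 //.
have D0 : tofrac Delta != 0 by rewrite tofrac_eq0.
have -> : \sum_k iterA A m i k * A k j =
    tofrac (\sum_k iterA_numer m i k * B k j) / tofrac (Delta ^+ m.+1).
  rewrite (rmorph_sum (@tofrac _)) mulr_suml; apply: eq_bigr => k _ /=.
  rewrite IH tofracM -defB exprS tofracM mulrCA -mulf_div divff // mul1r.
  by rewrite mulrAC.
set c := iterA_numer m i j; set t := \sum_k _.
have dD : Delta * (Delta ^+ m)^`() = Delta^`() *+ m * Delta ^+ m.
  rewrite deriv_exp; case: m {IH c t} => [|m]; first by rewrite !mulr0n mulr0 mul0r.
  by rewrite mulrnAr mulrCA mulrnAl -exprS.
rewrite [in RHS]tofracD mulrDl; congr (_ + _); apply/eqP.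
rewrite eqr_div ?tofrac_eq0 ?expf_neq0 // -!tofracM tofrac_eq exprS; apply/eqP.
transitivity (Delta ^+ m *
  (Delta * Delta ^+ m * c^`() - c * (Delta * (Delta ^+ m)^`()))).
  by ring.
by rewrite dD expr2; ring.
Qed.

Lemma evalmx_iterA m z : Delta.[z] != 0 ->
  evalmx (iterA A m) z =
    Delta.[z] ^- m *: map_mx (fun p => p.[z]) (iterA_numer m).
Proof.
move=> Dz; apply/matrixP => i j; rewrite !mxE iterAE rateval_div.
  by rewrite horner_exp mulrC.
by rewrite horner_exp expf_neq0.
Qed.

Lemma iterA_numer_over (S : subringClosed K) : Delta \is a polyOver S ->
  (forall i j, B i j \is a polyOver S) ->
  forall m i j, iterA_numer m i j \is a polyOver S.
Proof.
move=> DS BS; elim=> [|m IH] i j; first by rewrite /= mxE rpred_nat.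
rewrite /= !mxE rpredD ?rpredB //.
- by rewrite rpredM // polyOver_deriv.
- by rewrite rpredM ?rpredMn // polyOver_deriv.
- by rewrite rpred_sum // => k _; rewrite rpredM.
Qed.

End IteratedDerivation.

(** * Taylor coefficients of the solution *)

Section Solution.
Variables (K : numFieldType) (n : nat) (A : 'M[{fraction {poly K}}]_n).
Variables (Delta : {poly K}) (B : 'M[{poly K}]_n).
Hypothesis defB : forall i j, tofrac Delta * A i j = tofrac (B i j).

Lemma is_derive_inv_horner (z : K) m : Delta.[z] != 0 ->
  is_derive z (1 : K) (fun x => Delta.[x]^-1 ^+ m)
    (- (m%:R * Delta^`().[z] * Delta.[z]^-1 ^+ m.+1)).
Proof.
move=> Dz; have dD := is_derive_horner Delta z.
have dV : is_derive z (1 : K) (fun x => Delta.[x]^-1)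
    (- (Delta^`().[z] * Delta.[z]^-1 ^+ 2)).
  have derD := @ex_derive _ _ _ _ _ _ _ dD.
  apply: DeriveDef; first exact: derivableV.
  by rewrite deriveV // derive_val [_ *: _]mulrC mulrN exprVn.
elim: m => [|m IH]; first by rewrite !mul0r oppr0; exact: is_derive_cst.
under eq_fun => x do rewrite exprS.
apply: (is_derive_eq (is_derive_mul dV IH)).
by rewrite -natr1 !exprS; ring.
Qed.

(** The derivatives y^(m) = A_m y are exhibited as Delta^-m B_m y, whose
    differentiability near z0 and derivative follow from those of y alone. *)
Lemma solution_has_jet z0 y0 y : Delta.[z0] != 0 -> is_solution A z0 y0 y ->
  forall i M, has_jet z0 M (y i)
    (trunc (fun m => (m`!%:R)^-1 * (evalmx (iterA A m) z0 *m y0) i 0) M).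
Proof.
move=> Dz0 [yd yA yz0] i M.
have Delta0 : Delta != 0 by apply: contraNneq Dz0 => ->; rewrite horner0.
have cD : {for z0, continuous (horner Delta)}%classic.
  apply/differentiable_continuous/derivable1_diffP.
  by have [] := is_derive_horner Delta z0.
pose C := iterA_numer Delta B.
exists (fun m z =>
  (m`!%:R)^-1 * (Delta.[z]^-1 ^+ m * \sum_(j < n) (C m i j).[z] * y j z)).
split=> [z|m|m ltm].
- rewrite invr1 !mul1r (bigD1 i) //= mxE eqxx hornerC mul1r big1 ?addr0 // => j.
  by rewrite eq_sym mxE => /negPf ->; rewrite horner0 mul0r.
- have step (z : K) : Delta.[z] != 0 -> (forall j, derivable (y j) z (1 : K)) ->
      (forall j, (y j)^`()%classic z = (evalmx A z *m (\col_j y j z)) j 0) ->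
      is_derive z (1 : K) (fun z => (m`!%:R)^-1 *
          (Delta.[z]^-1 ^+ m * \sum_(j < n) (C m i j).[z] * y j z))
        (m.+1%:R * (((m.+1)`!%:R)^-1 *
          (Delta.[z]^-1 ^+ m.+1 * \sum_(j < n) (C m.+1 i j).[z] * y j z))).
    move=> Dz dy yAz.
    have dyz j : is_derive z (1 : K) (y j) (\sum_k (B j k).[z] / Delta.[z] * y k z).
      apply: DeriveDef => //; rewrite -derive1E yAz mxE; apply: eq_bigr => k _.
      rewrite !mxE; congr (_ * _); have -> : A j k = tofrac (B j k) / tofrac Delta.
        by rewrite -defB mulrAC divff ?mul1r // tofrac_eq0.
      exact: rateval_div.
    have dS : is_derive z (1 : K) (fun x => \sum_(j < n) (C m i j).[x] * y j x)
        (\sum_(j < n) ((C m i j)^`().[z] * y j z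
          + (C m i j).[z] * \sum_k (B j k).[z] / Delta.[z] * y k z)).
      apply: is_derive_bigsum => j.
      exact: is_derive_mul (is_derive_horner _ _) (dyz j).
    have d := is_derive_mul (is_derive_cst ((m`!%:R)^-1 : K) z 1)
      (is_derive_mul (is_derive_inv_horner m Dz) dS).
    apply: (is_derive_eq d); rewrite mul0r add0r /=.
    rewrite [RHS]mulrA factS natrM invfM mulVKf ?pnatr_eq0 //; congr (_ * _).
    set T := \sum_(j < n) (_ + _); set U := \sum_(j < n) (C m i j).[z] * y j z.
    have -> : \sum_(j < n) (C m.+1 i j).[z] * y j z =
        Delta.[z] * T - m%:R * Delta^`().[z] * U.
      rewrite /T /U !mulr_sumr -sumrB /C /=; under eq_bigr => j _.
        rewrite !mxE !hornerD hornerN !hornerM hornerMn horner_sum !mulrDl mulNr.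
        over.
      rewrite big_split /=; under [in RHS]eq_bigr => j _.
        rewrite mulrDr addrAC; over.
      rewrite [RHS]big_split /=; congr (_ + _).
        by apply: eq_bigr => j _; rewrite -mulr_natl !mulrA.
      under eq_bigr => j _ do rewrite mulr_suml.
      rewrite exchange_big /=; apply: eq_bigr => j _.
      rewrite !mulr_sumr; apply: eq_bigr => k _.
      by rewrite hornerM; field.
    by rewrite exprS; field.
  near=> z; apply: step; near: z; first exact: cvgr_neq0 cD Dz0.
    by apply: filter_forall => j; exact: yd.
  by apply: filter_forall => j; exact: yA.
- rewrite coef_poly ltm (evalmx_iterA Delta0 defB) // exprVn -scalemxAl !mxE.
  by congr (_ * (_ * _)); apply: eq_bigr => j _; rewrite !mxE yz0.
Unshelve. all: by end_near. Qed.
End Solution.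

(** * The main theorem *)

Lemma zero_modulo_prime_power (K : numFieldType) (S : subringClosed K)
    (N x : K) (p k m : nat) :
    prime p -> (k <= logn p m`!)%N -> N != 0 -> N ^+ m / m`!%:R * x \in S ->
  zero_modulo S N (p%:R ^+ k) x.
Proof.
move=> p_pr lek N0; set s := _ * x => sS.
have f0 : m`!%:R != 0 :> K by rewrite pnatr_eq0 -lt0n fact_gt0.
have Nm0 : N ^+ m != 0 by rewrite expf_neq0.
have xE : x = m`!%:R * s / N ^+ m by rewrite /s; field; rewrite f0 Nm0.
have /dvdnP[q defq] : (p ^ k %| m`!)%N by rewrite pfactor_dvdn ?fact_gt0.
split; first by exists (m`!%:R * s); [rewrite rpredM ?rpred_nat | exists m].
exists (q%:R * s / N ^+ m).
  by exists (q%:R * s); [rewrite rpredM ?rpred_nat | exists m].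
by rewrite [LHS]xE defq natrM natrX [q%:R * _]mulrC -!mulrA.
Qed.

Theorem theorem1p3 (R : realType) (n : nat)
    (A : 'M[{fraction {poly Cplx R}}]_n) (Delta : {poly Cplx R})
    (hDelta : common_denominator A Delta)
    (S : subringClosed (Cplx R)) (hS : finitely_generated S)
    (hDeltaS : Delta \is a polyOver S)
    (hAS : forall (i j : 'I_n) (b : {poly Cplx R}),
        tofrac Delta * A i j = tofrac b -> b \is a polyOver S)
    (z0 : Cplx R) (hz0 : z0 \in S) (hDz0 : Delta.[z0] != 0)
    (y0 : 'cV[Cplx R]_n) (hy0 : forall i, y0 i 0 \in S)
    (y : 'I_n -> Cplx R -> Cplx R) (hy : is_solution A z0 y0 y)
    (halg : forall i, algebraic_near (y i) z0) :
  exists N : Cplx R,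
    [/\ N \in S, N != 0,
        forall (m : nat) (i : 'I_n),
          (N ^+ m / (m`!)%:R *: (evalmx (iterA A m) z0 *m y0)) i 0 \in S
      & forall p k m : nat, prime p -> (k <= logn p m`!)%N ->
          forall i : 'I_n,
            zero_modulo S N (p%:R ^+ k) ((evalmx (iterA A m) z0 *m y0) i 0)].
Proof.
have [Delta0 AD] := hDelta.
pose B := \matrix_(i < n, j < n) sval (cid (AD i j)).
have defB i j : tofrac Delta * A i j = tofrac (B i j).
  by rewrite mxE; exact: svalP (cid (AD i j)).
have BS i j : B i j \is a polyOver S := hAS _ _ _ (defB i j).
pose x m i := (evalmx (iterA A m) z0 *m y0) i 0.
pose a i m := (m`!%:R)^-1 * x m i.
have xF m i : x m i \in fractions S.
  rewrite /x (evalmx_iterA Delta0 defB) // -scalemxAl !mxE.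
  rewrite rpredM //.
    by rewrite rpredV rpredX // mem_fractions // rpred_horner.
  rewrite mem_fractions // rpred_sum // => j _; rewrite !mxE rpredM //.
  by rewrite rpred_horner // (iterA_numer_over hDeltaS BS).
have aF i m : a i m \in fractions S by rewrite rpredM // rpredV rpred_nat.
have a0 i : a i 0 \in S.
  rewrite /a invr1 mul1r /x (evalmx_iterA Delta0 defB) //= expr0 invr1 scale1r.
  have -> : map_mx (fun p => p.[z0]) 1%:M = 1%:M :> 'M[Cplx R]_n.
    apply/matrixP => j k; rewrite !mxE.
    by case: (j == k); rewrite ?hornerC ?horner0.
  by rewrite mul1mx.
have exN i : exists N, [/\ N \in S, N != 0 & forall m, N ^+ m * a i m \in S].
  have [Q Q0 annQ] := algebraic_near_annihilator
    (solution_has_jet defB hDz0 hy i) (halg i).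
  exact: algebraic_series_denominators (pchar_num _) _ _ Q0 annQ (aF i) (a0 i).
pose N i := sval (cid (exN i)).
have NP i : [/\ N i \in S, N i != 0 & forall m, N i ^+ m * a i m \in S].
  exact: svalP (cid (exN i)).
pose M := \prod_i N i.
have MS : M \in S by apply: rpred_prod => i _; have [] := NP i.
have M0 : M != 0 by apply/prodf_neq0 => i _; have [] := NP i.
have Ma m i : M ^+ m / m`!%:R * x m i \in S.
  rewrite -mulrA -/(a i m) /M (bigD1 i) //= exprMn mulrAC rpredM //.
    by have [_ _] := NP i; apply.
  by apply/rpredX/rpred_prod => j _; have [] := NP j.
exists M; split=> // [m i|p k m p_pr lek i]; first by rewrite mxE; exact: Ma.
exact: zero_modulo_prime_power p_pr lek M0 (Ma m i).
Qed.
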